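(* Let $(\mathfrak{g},\omega,j,\cdot)$ be a special Kähler Lie algebra and let $D\in \mathfrak{sp}(\mathfrak{g},\omega)$ be a derivation of the left symmetric algebra $(\mathfrak{g},\cdot)$ verifying $[D,j]=0$. Then the vector space $\hat{\mathfrak{g}}:=\mathbb{R}e\oplus \mathfrak{g} \oplus \mathbb{R}d$ equipped with (i) the Lie bracket $[\cdot,\cdot]$ determined by: $[\cdot,\cdot]|_{\mathfrak{g}}=[\cdot,\cdot]_{\mathfrak{g}}$, $e\in\mathfrak{z}(\hat{\mathfrak{g}})$ (the center), and $[d,x]=D(x)$ for $x\in\mathfrak{g}$; (ii) the non-degenerate scalar 2-cocycle $\widetilde{\omega}$ determined by: $\widetilde{\omega}|_{\mathfrak{g}}=\omega$, $\widetilde{\omega}(e,d)=1$, and $\mathrm{Vect}_{\mathbb{R}}\{e,d\}\perp_{\widetilde{\omega}}\mathfrak{g}$; (iii) the left symmetric product $\diamond$ determined by: $\diamond|_{\mathfrak{g}}=\cdot$, $e\diamond\hat{\mathfrak{g}}=\hat{\mathfrak{g}}\diamond e=\hat{\mathfrak{g}}\diamond d=d\diamond(\mathbb{R}e\oplus\mathbb{R}d)=\{0\}$, and $d\diamond x=D(x)$ for $x\in\mathfrak{g}$; (iv) and the integrable complex structure $\widetilde{j}$ determined by: $\widetilde{j}|_{\mathfrak{g}}=j$ and $\widetilde{j}(e)=d$, is another special Kähler Lie algebra.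
   Context: Special Kähler Lie algebra: a finite dimensional real Lie algebra $\mathfrak{g}$ with a triple $(\omega,j,\cdot)$ where $\omega$ is a non-degenerate skew-symmetric bilinear form that is a scalar 2-cocycle ($\omega([x,y],z)+\omega([y,z],x)+\omega([z,x],y)=0$); $j$ is an integrable complex structure ($j^2=-\mathrm{Id}$, $[jx,jy]-[x,y]=j[jx,y]+j[x,jy]$); $\cdot$ is a left symmetric product ($x\cdot(y\cdot z)-(x\cdot y)\cdot z=y\cdot(x\cdot z)-(y\cdot x)\cdot z$); and for all $x,y,z$: (i) $k(x,y)=\omega(x,j(y))$ is symmetric and non-degenerate; (ii) $[x,y]=x\cdot y-y\cdot x$; (iii) $\omega(x\cdot y,z)+\omega(y,x\cdot z)=0$; (iv) $j([x,y])=x\cdot j(y)-y\cdot j(x)$. $D\in\mathfrak{sp}(\mathfrak{g},\omega)$ means $\omega(D(x),y)+\omega(x,D(y))=0$; $D$ is a derivation of $(\mathfrak{g},\cdot)$ if $D(x\cdot y)=D(x)\cdot y+x\cdot D(y)$; $[D,j]=D\circ j-j\circ D$. *)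

(* Defs.v *)
From HB Require Import structures.
From mathcomp Require Import all_boot all_order all_algebra.
From mathcomp Require Import boolp reals lra.

Set Implicit Arguments.
Unset Strict Implicit.
Unset Printing Implicit Defensive.

Import Order.TTheory GRing.Theory Num.Theory.

Local Open Scope ring_scope.

Section LinearFor.
Variables (R : nzRingType) (U : lmodType R) (W : zmodType).
Variable s : GRing.Scale.law R W.
Implicit Types f g : U -> W.

Lemma linear_for_eq0 f : GRing.linear_for (s : R -> W -> W) f -> f 0 = 0.
Proof. by move=> fL; have := zmod_morphism_linear fL 0 0; rewrite !subrr. Qed.

Lemma linear_for_add f : GRing.linear_for (s : R -> W -> W) f ->
  {morph f : x y / x + y}.
Proof.
move=> fL x y; have fB := zmod_morphism_linear fL.
rewrite -{1}[y]opprK fB; congr (_ + _).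
by rewrite -[- y]sub0r fB (linear_for_eq0 fL) sub0r opprK.
Qed.

Lemma linear_for_sum f g :
    GRing.linear_for (s : R -> W -> W) f ->
    GRing.linear_for (s : R -> W -> W) g ->
  GRing.linear_for (s : R -> W -> W) (fun u => f u + g u).
Proof.
move=> fL gL a u v; rewrite fL gL addrACA; congr (_ + _).
have [_ sD] := GRing.Scale.op_nmod_morphism (s := s) a; exact/esym/sD.
Qed.

Lemma linear_for_opp f :
    GRing.linear_for (s : R -> W -> W) f ->
  GRing.linear_for (s : R -> W -> W) (fun u => - f u).
Proof.
move=> fL a u v; rewrite fL opprD; congr (_ - _).
have [s0 sD] := GRing.Scale.op_nmod_morphism (s := s) a.
by apply/eqP; rewrite eq_sym -addr_eq0 -sD addNr s0.
Qed.

End LinearFor.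

Section LinearScale.
Variables (R : realType) (U V W : lmodType R).

Lemma linear_scalel (f : U -> R) (x : W) :
  GRing.linear_for *%R f -> linear (fun u => f u *: x).
Proof. by move=> fL a u v; rewrite fL scalerDl scalerA. Qed.

Lemma linear_scaler (f : U -> V) (g : {linear V -> W}) (b : R) :
  linear f -> linear (fun u => b *: g (f u)).
Proof.
by move=> fL a u v; rewrite fL linearP scalerDr !scalerA [b * a]mulrC.
Qed.

Lemma scalar_mull (f : U -> R) (b : R) :
  GRing.linear_for *%R f -> GRing.linear_for *%R (fun u => f u * b).
Proof. by move=> fL a u v; rewrite fL mulrDl mulrA. Qed.

Lemma scalar_mulr (f : U -> R) (b : R) :
  GRing.linear_for *%R f -> GRing.linear_for *%R (fun u => b * f u).
Proof. by move=> fL a u v; rewrite fL mulrDr mulrCA. Qed.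

End LinearScale.

Section SpecialKahler.
Variables (R : realType) (V : vectType R).
Implicit Types (br pr : V -> V -> V) (b om : V -> V -> R) (j : V -> V).

Definition bilinear_op pr : Prop := bilinear_for *:%R *:%R pr.

Definition bilinear_form b : Prop := bilinear_for *%R *%R b.

(* One-sided; for the symmetric and skew-symmetric forms considered here it
   agrees with the triviality of the other radical. *)
Definition nondegenerate_form b : Prop :=
  forall x, (forall y, b x y = 0) -> x = 0.

Record Lie_bracket br : Prop := {
  Lie_bilinear : bilinear_op br;
  Lie_alternating : forall x, br x x = 0;
  Lie_Jacobi : forall x y z,
    br x (br y z) + br y (br z x) + br z (br x y) = 0
}.

Record nondegenerate_2cocycle br om : Prop := {
  cocycle_bilinear : bilinear_form om;
  cocycle_skew : forall x y, om x y = - om y x;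
  cocycle_nondegenerate : nondegenerate_form om;
  cocycle_closed : forall x y z,
    om (br x y) z + om (br y z) x + om (br z x) y = 0
}.

Record integrable_complex_structure br j : Prop := {
  complex_linear : linear j;
  complex_sqr : forall x, j (j x) = - x;
  complex_integrable : forall x y,
    br (j x) (j y) - br x y = j (br (j x) y) + j (br x (j y))
}.

Record left_symmetric_product pr : Prop := {
  lsym_bilinear : bilinear_op pr;
  lsym_assoc : forall x y z,
    pr x (pr y z) - pr (pr x y) z = pr y (pr x z) - pr (pr y x) z
}.

Definition kahler_metric om j (x y : V) : R := om x (j y).

Record special_Kahler_Lie_algebra br om j pr : Prop := {
  sk_Lie : Lie_bracket br;
  sk_cocycle : nondegenerate_2cocycle br om;
  sk_complex : integrable_complex_structure br j;
  sk_lsym : left_symmetric_product pr;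
  sk_metric_sym : forall x y, kahler_metric om j x y = kahler_metric om j y x;
  sk_metric_nondegenerate : nondegenerate_form (kahler_metric om j);
  sk_torsion_free : forall x y, br x y = pr x y - pr y x;
  sk_symplectic : forall x y z, om (pr x y) z + om y (pr x z) = 0;
  sk_special : forall x y, j (br x y) = pr x (j y) - pr y (j x)
}.

Definition in_sp om (D : 'End(V)) : Prop :=
  forall x y, om (D x) y + om x (D y) = 0.

Definition derivation pr (D : 'End(V)) : Prop :=
  forall x y, D (pr x y) = pr (D x) y + pr x (D y).

End SpecialKahler.

(* The vector space Re (+) V (+) Rd: the triple (a, x, b) is a e + x + b d. *)
Section DoubleExtension.
Variables (R : realType) (V : vectType R).

Definition ext : vectType R := (R^o * V * R^o)%type.

Implicit Types (u v : ext) (br pr : V -> V -> V) (om : V -> V -> R).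
Implicit Types (j : V -> V) (D : 'End(V)).

Definition mkext (a : R) (x : V) (b : R) : ext := (a, x, b).
Definition ecoord u : R := u.1.1.
Definition gpart u : V := u.1.2.
Definition dcoord u : R := u.2.

Definition e_ext : ext := mkext 1 0 0.
Definition d_ext : ext := mkext 0 0 1.
Definition g_ext (x : V) : ext := mkext 0 x 0.

Definition ext_br br D u v : ext :=
  g_ext (br (gpart u) (gpart v)
         + dcoord u *: D (gpart v) - dcoord v *: D (gpart u)).

Definition ext_om om u v : R :=
  om (gpart u) (gpart v) + ecoord u * dcoord v - dcoord u * ecoord v.

Definition ext_pr pr D u v : ext :=
  g_ext (pr (gpart u) (gpart v) + dcoord u *: D (gpart v)).

Definition ext_j j u : ext := mkext (- dcoord u) (j (gpart u)) (ecoord u).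

Lemma extE u : u = ecoord u *: e_ext + g_ext (gpart u) + dcoord u *: d_ext.
Proof.
case: u => -[a x] b; congr (_, _, _) => /=.
- by rewrite /ecoord /dcoord /= [_ *: 1]mulr1 addr0 scaler0 addr0.
- by rewrite !scaler0 add0r addr0.
- by rewrite /ecoord /dcoord /= scaler0 !add0r [_ *: 1]mulr1.
Qed.

Lemma linear_ext (W : zmodType) (s : GRing.Scale.law R W) (f : ext -> W) :
    GRing.linear_for (s : R -> W -> W) f ->
  forall u, f u = s (ecoord u) (f e_ext) + f (g_ext (gpart u))
                  + s (dcoord u) (f d_ext).
Proof.
move=> fL u; have fZ := scalable_linear fL; have fD := linear_for_add fL.
by rewrite [in LHS](extE u) !fD !fZ.
Qed.

Lemma bilinear_ext (W : zmodType) (s : GRing.Scale.law R W)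
    (B : ext -> ext -> W) :
    bilinear_for s s B ->
  forall u v, B u v =
    s (ecoord u) (B e_ext v)
    + (s (ecoord v) (B (g_ext (gpart u)) e_ext)
       + B (g_ext (gpart u)) (g_ext (gpart v))
       + s (dcoord v) (B (g_ext (gpart u)) d_ext))
    + s (dcoord u)
        (s (ecoord v) (B d_ext e_ext) + B d_ext (g_ext (gpart v))
         + s (dcoord v) (B d_ext d_ext)).
Proof.
case=> Bl Br u v; rewrite (linear_ext (Bl v)).
by rewrite (linear_ext (Br (g_ext _)) v) (linear_ext (Br d_ext) v).
Qed.

Lemma g_ext_linear : linear g_ext.
Proof.
by move=> a x y; congr (_, _, _) => //=; rewrite [a *: _]mulr0 addr0.
Qed.

Lemma ecoord_linear : GRing.linear_for (@GRing.mul R) ecoord.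
Proof. by []. Qed.

Lemma gpart_linear : linear gpart.
Proof. by []. Qed.

Lemma dcoord_linear : GRing.linear_for (@GRing.mul R) dcoord.
Proof. by []. Qed.

Lemma linear_g_ext (f : ext -> V) : linear f -> linear (fun u => g_ext (f u)).
Proof. by move=> fL a u v; rewrite fL g_ext_linear. Qed.

Lemma ext_br_bilinear br D : bilinear_op br -> bilinear_op (ext_br br D).
Proof.
case=> brl brr; split=> w; apply: linear_g_ext;
  (apply: linear_for_sum; [apply: linear_for_sum|apply: linear_for_opp]).
- by move=> a u v; exact: (brl _ a).
- exact: linear_scalel dcoord_linear.
- exact: linear_scaler gpart_linear.
- by move=> a u v; exact: (brr _ a).
- exact: linear_scaler gpart_linear.
- exact: linear_scalel dcoord_linear.
Qed.

Lemma ext_pr_bilinear pr D : bilinear_op pr -> bilinear_op (ext_pr pr D).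
Proof.
case=> prl prr; split=> w; apply: linear_g_ext; apply: linear_for_sum.
- by move=> a u v; exact: (prl _ a).
- exact: linear_scalel dcoord_linear.
- by move=> a u v; exact: (prr _ a).
- exact: linear_scaler gpart_linear.
Qed.

Lemma ext_om_bilinear om : bilinear_form om -> bilinear_form (ext_om om).
Proof.
case=> oml omr; split=> w;
  (apply: linear_for_sum; [apply: linear_for_sum|apply: linear_for_opp]).
- by move=> a u v; exact: (oml _ a).
- exact: scalar_mull ecoord_linear.
- exact: scalar_mull dcoord_linear.
- by move=> a u v; exact: (omr _ a).
- exact: scalar_mulr dcoord_linear.
- exact: scalar_mulr ecoord_linear.
Qed.

(* The four *_determined lemmas below show that the coordinate formulas above are the only
   operations of the relevant kind with the prescribed values. *)

Lemma ext_br_determined br D (B : ext -> ext -> ext) :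
    bilinear_op br -> (forall x, br x x = 0) ->
  [/\ bilinear_op B, (forall u, B u u = 0),
      (forall x y, B (g_ext x) (g_ext y) = g_ext (br x y)),
      (forall u, B e_ext u = 0) &
      (forall x, B d_ext (g_ext x) = g_ext (D x))]
  <-> B = ext_br br D.
Proof.
move=> brL br0; have extL := ext_br_bilinear D brL; split=> [|->].
  case=> BL B0 Bg Be Bd; apply/funext=> u; apply/funext=> v.
  have skew w w' : B w w' = - B w' w.
    apply/eqP; rewrite -addr_eq0; apply/eqP.
    have := B0 (w + w'); rewrite (linear_for_add (BL.1 _)).
    by rewrite !(linear_for_add (BL.2 _)) !B0 add0r addr0.
  rewrite (bilinear_ext BL) /= Be Bg Bd (skew _ e_ext) (skew _ d_ext).
  rewrite (skew d_ext e_ext) !Be Bd B0 oppr0 !scaler0 !add0r addr0.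
  rewrite scalerN /ext_br; have gL := g_ext_linear.
  rewrite !(linear_for_add gL) [LHS]addrAC.
  congr (_ + _ + _); first by rewrite (scalable_linear gL).
  by rewrite -!scaleN1r (scalable_linear gL) (scalable_linear gL).
have br0l := linear_for_eq0 (brL.1 _); have br0r := linear_for_eq0 (brL.2 _).
split=> //.
- by move=> u; rewrite /ext_br br0 add0r subrr.
- by move=> x y; rewrite /ext_br /dcoord /= !scale0r subr0 addr0.
- by move=> u; rewrite /ext_br /dcoord /gpart /= br0l linear0 scale0r scaler0 subr0 addr0.
- by move=> x; rewrite /ext_br /dcoord /gpart /= br0l scale1r scale0r subr0 add0r.
Qed.

Lemma ext_om_determined om (B : ext -> ext -> R) :
    bilinear_form om -> (forall x y, om x y = - om y x) ->
  [/\ bilinear_form B, (forall u v, B u v = - B v u),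
      (forall x y, B (g_ext x) (g_ext y) = om x y),
      B e_ext d_ext = 1 &
      (forall x, B e_ext (g_ext x) = 0 /\ B d_ext (g_ext x) = 0)]
  <-> B = ext_om om.
Proof.
move=> omL oms; have extL := ext_om_bilinear omL; split=> [|->].
  case=> BL skew Bg Bed B0; apply/funext=> u; apply/funext=> v.
  have B00 w : B w w = 0 by have := skew w w; lra.
  have [Be Bd] : (forall x, B e_ext (g_ext x) = 0) /\
                 (forall x, B d_ext (g_ext x) = 0).
    by split=> x; case: (B0 x).
  rewrite (bilinear_ext BL) /= (linear_ext (BL.2 e_ext)) Be Bg Bd.
  rewrite (skew (g_ext _) e_ext) (skew (g_ext _) d_ext) (skew d_ext e_ext).
  by rewrite Be Bd Bed !B00 /ext_om /=; lra.
have om0l := linear_for_eq0 (omL.1 _); have om0r := linear_for_eq0 (omL.2 _).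
split=> //.
- by move=> u v; rewrite /ext_om oms; lra.
- by move=> x y; rewrite /ext_om /ecoord /dcoord /gpart /=; lra.
- by rewrite /ext_om /ecoord /dcoord /gpart /= om0l; lra.
- by move=> x; rewrite /ext_om /ecoord /dcoord /gpart /= om0l; split; lra.
Qed.

Lemma ext_pr_determined pr D (B : ext -> ext -> ext) :
    bilinear_op pr ->
  [/\ bilinear_op B,
      (forall x y, B (g_ext x) (g_ext y) = g_ext (pr x y)),
      (forall u, [/\ B e_ext u = 0, B u e_ext = 0 & B u d_ext = 0]),
      (B d_ext e_ext = 0 /\ B d_ext d_ext = 0) &
      (forall x, B d_ext (g_ext x) = g_ext (D x))]
  <-> B = ext_pr pr D.
Proof.
move=> prL; have extL := ext_pr_bilinear D prL; split=> [|->].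
  case=> BL Bg B0 [Bde Bdd] Bd; apply/funext=> u; apply/funext=> v.
  have [Bev _ _] := B0 v; have [_ Bge Bgd] := B0 (g_ext (gpart u)).
  rewrite (bilinear_ext BL) /= Bev Bge Bgd Bg Bde Bdd Bd !scaler0 !(add0r, addr0).
  have gL := g_ext_linear.
  by rewrite /ext_pr (linear_for_add gL) (scalable_linear gL).
have pr0l := linear_for_eq0 (prL.1 _); have pr0r := linear_for_eq0 (prL.2 _).
split=> //.
- by move=> x y; rewrite /ext_pr /dcoord /= scale0r addr0.
- by move=> u; split; rewrite /ext_pr /dcoord /gpart /= ?pr0l ?pr0r
    ?linear0 ?scale0r ?scaler0 addr0.
- by split; rewrite /ext_pr /dcoord /gpart /= pr0l linear0 scaler0 addr0.
- by move=> x; rewrite /ext_pr /dcoord /gpart /= pr0l scale1r add0r.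
Qed.

Lemma ext_j_determined j (f : ext -> ext) :
    linear j -> (forall x, j (j x) = - x) ->
  [/\ linear f, (forall u, f (f u) = - u),
      (forall x, f (g_ext x) = g_ext (j x)) & f e_ext = d_ext]
  <-> f = ext_j j.
Proof.
move=> jL jj; have j0 := linear_for_eq0 jL; split=> [[fL ff fg fe]|->].
  apply/funext=> u; have fd : f d_ext = - e_ext by rewrite -fe ff.
  rewrite (linear_ext fL) /= fe fd fg [RHS]extE /ext_j /ecoord /dcoord /gpart /=.
  by rewrite scalerN scaleNr [LHS]addrC [X in _ + X]addrC addrA.
split=> //.
- move=> a u v; rewrite /ext_j; congr (_, _, _) => //=; last exact: jL.
  by rewrite /dcoord /= opprD -mulrN.
- by move=> [[a x] b]; congr (_, _, _); exact: jj.
- by move=> x; congr (_, _, _); rewrite /dcoord /= oppr0.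
- by congr (_, _, _); rewrite /dcoord /= ?oppr0 // /gpart /= j0.
Qed.

End DoubleExtension.

(* Main.v *)
Require Import Defs.
From mathcomp Require Import all_boot all_order all_algebra.
From mathcomp Require Import reals.
From mathcomp Require Import lra.

(** Once the bracket is the commutator of a left symmetric product whose left
    multiplications [L x = pr x] preserve [om], most of the axioms are
    redundant: Jacobi is the left symmetry summed cyclically, the cocycle
    identity follows from the invariance of [om], and the integrability of [j]
    follows from [j [x, y] = x . j y - y . j x] applied to the pairs
    [(j x, y)] and [(x, j y)].  This is [special_Kahler_criterion]; it spares
    any computation with the extended bracket.

    On the double extension, left multiplication by [a e + x + b d] is
    [L x + b D] on [g] and zero on the plane of [e] and [d].  It preserves the
    extended form because both [L x] and [D] preserve [om]; the extended
    product is left symmetric because [D] is a derivation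
    ([associator_ext_pr]); and the compatibility with [j] holds because [D]
    commutes with [j].  The metric is the orthogonal sum of the metric of [g]
    and of the Euclidean plane spanned by [e] and [d]. *)

Import GRing.Theory.
Local Open Scope ring_scope.

(** * Redundancies among the axioms *)

Section Criterion.
Variables (R : realType) (V : vectType R).
Implicit Types (br pr : V -> V -> V) (om : V -> V -> R) (j : V -> V).

Lemma commutator_bilinear br pr :
    bilinear_op pr -> (forall x y, br x y = pr x y - pr y x) ->
  bilinear_op br.
Proof.
by case=> prl prr brE; split=> w a u v; rewrite /= !brE (prl _ a) (prr _ a) /=;
   rewrite scalerBr opprD addrACA.
Qed.

Lemma left_symmetric_commutator pr :
    left_symmetric_product pr ->
  forall x y z, pr (pr x y - pr y x) z = pr x (pr y z) - pr y (pr x z).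
Proof.
case=> [[prl _] prA] x y z; rewrite (zmod_morphism_linear (prl z)) /=.
apply/esym/subr0_eq; rewrite opprD addrACA -opprD.
by apply/eqP; rewrite subr_eq0; apply/eqP/prA.
Qed.

(** Left symmetry turns [[y, z] . x] into [y . (z . x) - z . (y . x)].  Hence
    [[x, [y, z]]] is a signed sum of right-nested triple products, grouped
    below so that its sum over cyclic permutations telescopes. *)
Lemma commutator_Jacobi br pr :
    left_symmetric_product pr -> (forall x y, br x y = pr x y - pr y x) ->
  forall x y z, br x (br y z) + br y (br z x) + br z (br x y) = 0.
Proof.
move=> prS brE x y z.
have brbr u v w : br u (br v w) =
    (pr u (pr v w) + pr w (pr v u)) - (pr u (pr w v) + pr v (pr w u)).
  rewrite !brE (left_symmetric_commutator _ prS).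
  rewrite (zmod_morphism_linear ((lsym_bilinear prS).2 u)) /=.
  by rewrite opprB [in RHS]opprD addrACA.
rewrite !brbr [pr y (pr z x) + _]addrC subrKA.
by rewrite [pr z (pr x y) + _]addrC subrKA [X in _ - X]addrC subrr.
Qed.

(** Invariance and skewness make [om (x . y) z] symmetric in [y] and [z], so
    the six terms of the cyclic sum cancel in pairs. *)
Lemma symplectic_commutator_closed br om pr :
    bilinear_form om -> (forall x y, om x y = - om y x) ->
    (forall x y, br x y = pr x y - pr y x) ->
    (forall x y z, om (pr x y) z + om y (pr x z) = 0) ->
  forall x y z, om (br x y) z + om (br y z) x + om (br z x) y = 0.
Proof.
move=> [oml _] oms brE omS x y z.
rewrite !brE !(zmod_morphism_linear (oml _)) /=.
have prE u v w : om (pr u v) w = om (pr u w) v.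
  by have := omS u v w; rewrite (oms v); lra.
by rewrite (prE y x) (prE z y) (prE x z); lra.
Qed.

(** On the right-hand side [j (j x) = - x] turns the terms [- y . j (j x)] and
    [x . j (j y)] into [y . x - x . y], which is [- [x, y]]. *)
Lemma special_integrable br j pr :
    bilinear_op pr -> (forall x, j (j x) = - x) ->
    (forall x y, br x y = pr x y - pr y x) ->
    (forall x y, j (br x y) = pr x (j y) - pr y (j x)) ->
  forall x y, br (j x) (j y) - br x y = j (br (j x) y) + j (br x (j y)).
Proof.
move=> [_ prr] jj brE jbr x y; rewrite !jbr !jj !brE.
have prN u v : pr u (- v) = - pr u v.
  by rewrite -!scaleN1r (scalable_linear (prr u)).
by rewrite !prN !opprK opprB addrACA [X in _ + X = _]addrC.
Qed.

Lemma kahler_metric_nondegenerate om j :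
    nondegenerate_form om -> (forall x, j (j x) = - x) ->
  nondegenerate_form (kahler_metric om j).
Proof.
move=> omN jj x kx0; apply: omN => y.
(* [j (j (j y)) = - j y] is the preimage of [y] under [j]. *)
by have := kx0 (j (j (j y))); rewrite /kahler_metric !jj opprK.
Qed.

(** The axioms that have to be checked by hand when the bracket is given as a
    commutator; the others are the redundancies proved above. *)
Lemma special_Kahler_criterion br om j pr :
    bilinear_form om -> (forall x y, om x y = - om y x) ->
    nondegenerate_form om ->
    linear j -> (forall x, j (j x) = - x) ->
    left_symmetric_product pr ->
    (forall x y, kahler_metric om j x y = kahler_metric om j y x) ->
    (forall x y, br x y = pr x y - pr y x) ->
    (forall x y z, om (pr x y) z + om y (pr x z) = 0) ->
    (forall x y, j (br x y) = pr x (j y) - pr y (j x)) ->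
  special_Kahler_Lie_algebra br om j pr.
Proof.
move=> omL oms omN jL jj prS kS brE omS jbr.
have prL := lsym_bilinear prS.
split=> //.
- split; first exact: commutator_bilinear prL brE.
    by move=> x; rewrite brE subrr.
  exact: commutator_Jacobi prS brE.
- split=> //; exact: symplectic_commutator_closed brE omS.
- split=> //; exact: special_integrable prL jj brE jbr.
- exact: kahler_metric_nondegenerate.
Qed.

End Criterion.

(** * The double extension *)

Section DoubleExtension.
Variables (R : realType) (V : vectType R).
Implicit Types (br pr : V -> V -> V) (om : V -> V -> R) (j : V -> V).
Implicit Types (D : 'End(V)) (u v w : ext V).

Lemma ext_om_skew om :
    (forall x y, om x y = - om y x) ->
  forall u v, ext_om om u v = - ext_om om v u.
Proof. by move=> oms u v; rewrite /ext_om oms; lra. Qed.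

Lemma ext_om_nondegenerate om :
    bilinear_form om -> nondegenerate_form om -> nondegenerate_form (ext_om om).
Proof.
move=> [_ omr] omN u u0; have om0 x : om x 0 = 0 := linear_for_eq0 (omr x).
(* Pairing with [d], [e] and [g] isolates each component in turn. *)
have a0 : ecoord u = 0.
  by have := u0 (d_ext V); rewrite /ext_om /= om0 /ecoord /dcoord /=; lra.
have b0 : dcoord u = 0.
  by have := u0 (e_ext V); rewrite /ext_om /= om0 /ecoord /dcoord /=; lra.
have x0 : gpart u = 0.
  apply: omN => y; have := u0 (g_ext y).
  by rewrite /ext_om /gpart /ecoord /dcoord /=; lra.
by rewrite (extE u) a0 b0 x0 !scale0r add0r addr0.
Qed.

Lemma ext_metricE om j u v :
  kahler_metric (ext_om om) (ext_j j) u v =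
  kahler_metric om j (gpart u) (gpart v)
  + ecoord u * ecoord v + dcoord u * dcoord v.
Proof.
by rewrite /kahler_metric /ext_om /ext_j /ecoord /dcoord /gpart /=; lra.
Qed.

(** Let [x], [y], [z] be the parts of [u], [v], [w] in [g], and [b] the
    [d]-coordinate of [u].  By the derivation property, [b D (y . z)] from the
    first term cancels [b (D y) . z] from the second and leaves a correction to
    the associator of [g] that is visibly symmetric in [u] and [v]. *)
Lemma associator_ext_pr pr D :
    bilinear_op pr -> derivation pr D ->
  forall u v w,
  ext_pr pr D u (ext_pr pr D v w) - ext_pr pr D (ext_pr pr D u v) w =
  g_ext (pr (gpart u) (pr (gpart v) (gpart w))
         - pr (pr (gpart u) (gpart v)) (gpart w)
         + (dcoord v *: pr (gpart u) (D (gpart w))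
            + dcoord u *: pr (gpart v) (D (gpart w)))
         + (dcoord u * dcoord v) *: D (D (gpart w))).
Proof.
move=> [prl prr] Dder u v w.
rewrite /ext_pr -(zmod_morphism_linear (@g_ext_linear _ _)).
congr g_ext.
set x := gpart u; set y := gpart v; set z := gpart w.
rewrite /gpart /dcoord /= scale0r addr0 -/(dcoord u) -/(dcoord v).
rewrite (linear_for_add (prr x)) (linear_for_add (prl z)) /=.
rewrite (scalable_linear (prr x)) (scalable_linear (prl z)) /=.
rewrite linearD linearZ /= Dder !scalerDr scalerA.
set c := dcoord u *: pr (D y) z.
rewrite -[c + _ + _]addrA [c + _]addrC [_ + c in X in _ - X]addrC addrA addrKA.
rewrite !addrA [LHS]addrAC; congr (_ + _).
by rewrite [LHS]addrAC [_ + _ - _]addrAC.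
Qed.

Lemma ext_pr_left_symmetric pr D :
    left_symmetric_product pr -> derivation pr D ->
  left_symmetric_product (ext_pr pr D).
Proof.
move=> [prL prA] Dder; split; first exact: ext_pr_bilinear.
move=> u v w; rewrite !(associator_ext_pr _ _ prL Dder) prA.
by rewrite [dcoord v *: _ + _]addrC [dcoord v * _]mulrC.
Qed.

Lemma ext_br_commutator br pr D :
    (forall x y, br x y = pr x y - pr y x) ->
  forall u v, ext_br br D u v = ext_pr pr D u v - ext_pr pr D v u.
Proof.
move=> brE u v.
rewrite /ext_br /ext_pr -(zmod_morphism_linear (@g_ext_linear _ _)).
by rewrite brE opprD [in RHS]addrA; congr (g_ext (_ + _)); exact: addrAC.
Qed.

Lemma ext_pr_symplectic om pr D :
    bilinear_form om ->
    (forall x y z, om (pr x y) z + om y (pr x z) = 0) -> in_sp om D ->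
  forall u v w,
  ext_om om (ext_pr pr D u v) w + ext_om om v (ext_pr pr D u w) = 0.
Proof.
move=> [oml omr] omS Dsp u v w; rewrite /ext_om /ext_pr.
set x := gpart u; set y := gpart v; set z := gpart w.
rewrite /gpart /dcoord /ecoord /= -/(dcoord u).
rewrite (linear_for_add (oml z)) (linear_for_add (omr y)) /=.
rewrite (scalable_linear (oml z)) (scalable_linear (omr y)) /=.
rewrite !mul0r !mulr0 !subr0 !addr0 addrACA omS add0r -mulrDr Dsp.
by rewrite mulr0.
Qed.

Lemma ext_special br j pr D :
    linear j -> (forall x, D (j x) = j (D x)) ->
    (forall x y, j (br x y) = pr x (j y) - pr y (j x)) ->
  forall u v, ext_j j (ext_br br D u v) =
    ext_pr pr D u (ext_j j v) - ext_pr pr D v (ext_j j u).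
Proof.
move=> jL Dj jbr u v.
rewrite /ext_pr -(zmod_morphism_linear (@g_ext_linear _ _)).
rewrite {1}/ext_j /ext_br /dcoord /ecoord /gpart /= -!/(gpart _) -!/(dcoord _).
rewrite oppr0; congr (mkext _ _ _).
rewrite (zmod_morphism_linear jL) (linear_for_add jL).
rewrite !(scalable_linear jL) /= jbr !Dj.
by rewrite opprD [in RHS]addrA; congr (_ + _); exact: addrAC.
Qed.

End DoubleExtension.

Theorem theorem5p4 (R : realType) (V : vectType R)
    (br : V -> V -> V) (om : V -> V -> R) (j : V -> V) (pr : V -> V -> V)
    (D : 'End(V)) :
  special_Kahler_Lie_algebra br om j pr ->
  in_sp om D ->
  derivation pr D ->
  (forall x, D (j x) - j (D x) = 0) ->
  special_Kahler_Lie_algebra (V := ext V)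
    (ext_br br D) (ext_om om) (ext_j j) (ext_pr pr D).
Proof.
move=> [_ [omL oms omN _] [jL jj _] prS kS _ brE omS jbr] Dsp Dder Dj0.
have Dj x : D (j x) = j (D x) by exact: subr0_eq.
have [ejL ejj _ _] := (ext_j_determined (ext_j j) jL jj).2 erefl.
apply: special_Kahler_criterion => //.
- exact: ext_om_bilinear.
- exact: ext_om_skew.
- exact: ext_om_nondegenerate.
- exact: ext_pr_left_symmetric.
- by move=> u v; rewrite !ext_metricE kS [ecoord u * _]mulrC [dcoord u * _]mulrC.
- exact: ext_br_commutator.
- exact: ext_pr_symplectic.
- exact: ext_special.
Qed.
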